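(* Let $d\in\mathbb{N}$, and let $V_n=H_{d,b}(X_1,\ldots,X_n)$ be the standard histogram estimator with $b=b(n)$ positive integers such that $n/b^d\to\infty$ as $n\to\infty$. There exists $p\in\mathfrak{Q}_d$ such that, when $X_1,\ldots,X_n\overset{iid}{\sim}p$, $\|V_n-p\|_1\in\omega\left(1/\sqrt[d]{n}\right)$.
   Context: $\mathbb{N}$ denotes the positive integers and $[b]=\{1,\ldots,b\}$; $\|\cdot\|_1$ is the $L^1$ norm on the unit cube. For $A\in[b]^d$ let $\Lambda_{d,b,A}=\prod_{i=1}^d\left[\frac{A_i-1}{b},\frac{A_i}{b}\right)$ and $h_{d,b,A}=b^d\,\mathbf{1}_{\Lambda_{d,b,A}}$. The standard histogram estimator for data $\mathcal{X}=(X_1,\ldots,X_n)$ in $[0,1)^d$ is $$H_{d,b}(\mathcal{X})=\frac1n\sum_{i=1}^n\sum_{A\in[b]^d}h_{d,b,A}\,\mathbf{1}(X_i\in\Lambda_{d,b,A}).$$ $\Delta_k$ is the set of vectors in $\mathbb{R}^k$ with nonnegative entries summing to one. For $L\ge0$, $\operatorname{Lip}_L$ is the set of $L$-Lipschitz probability density functions on $[0,1]$, and $$\mathfrak{Q}_d=\left\{\sum_{i=1}^{k'}w_i\,p_{i,1}\otimes\cdots\otimes p_{i,d}\;:\;k'\in\mathbb{N},\ w\in\Delta_{k'},\ L'\ge0,\ p_{i,j}\in\operatorname{Lip}_{L'}\right\},$$ where $(p_{i,1}\otimes\cdots\otimes p_{i,d})(x_1,\ldots,x_d)=\prod_{j=1}^d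 p_{i,j}(x_j)$. For random $f_n$ and positive $g_n$, $f_n\in\omega(g_n)$ means $|f_n/g_n|\to\infty$ in probability. *)

(* Defs.v *)
From HB Require Import structures.
From mathcomp Require Import all_boot all_order all_algebra finmap.
From mathcomp Require Import all_classical all_reals all_analysis.
Set Implicit Arguments.
Unset Strict Implicit.
Unset Printing Implicit Defensive.
Import Order.TTheory GRing.Theory Num.Theory.
Import numFieldNormedType.Exports.

Local Open Scope classical_set_scope.
Local Open Scope ring_scope.

(* Points of R^d, with the product sigma-algebra. *)
Notation euclid R d := (d.-tuple (measurableTypeR R)).

Section lebesgue_measure_euclid.
Variable R : realType.

Definition euclid_cons d (xt : measurableTypeR R * euclid R d) : euclid R d.+1 :=
  [tuple of xt.1 :: xt.2].

Lemma measurable_euclid_cons d : measurable_fun setT (@euclid_cons d).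
Proof. exact: measurable_cons. Qed.

Section step.
Variables (d : nat) (m : {sigma_finite_measure set (euclid R d) -> \bar R}).

Definition lebesgue_step : set (euclid R d.+1) -> \bar R :=
  pushforward (@lebesgue_measure R \x m)%E (@euclid_cons d).

Let step0 : lebesgue_step set0 = 0%E.
Proof. by rewrite /lebesgue_step /pushforward preimage_set0 measure0. Qed.

Let step_ge0 A : (0 <= lebesgue_step A)%E.
Proof. by rewrite /lebesgue_step /pushforward; apply: measure_ge0. Qed.

Let step_sigma_additive : semi_sigma_additive lebesgue_step.
Proof.
move=> F mF tF mUF; rewrite /lebesgue_step /pushforward preimage_bigcup.
apply: measure_semi_sigma_additive.
- move=> n; rewrite -[X in measurable X]setTI.
  exact: measurable_euclid_cons.
- apply/trivIsetP => /= i j _ _ ij; rewrite -preimage_setI.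
  by move/trivIsetP : tF => /(_ _ _ _ _ ij) ->//; rewrite preimage_set0.
- rewrite -preimage_bigcup -[X in measurable X]setTI.
  exact: measurable_euclid_cons.
Qed.

HB.instance Definition _ := isMeasure.Build _ _ _ lebesgue_step
  step0 step_ge0 step_sigma_additive.

Let step_sigma_finite : sigma_finite setT lebesgue_step.
Proof.
have /sigma_finiteP[F [FT ndF Foo]] := sigma_finiteT (@lebesgue_measure R).
have /sigma_finiteP[G [GT ndG Goo]] := sigma_finiteT m.
pose uncons (x : euclid R d.+1) : measurableTypeR R * euclid R d :=
  (thead x, [tuple of behead x]).
have consK : cancel uncons (@euclid_cons d).
  by move=> x; rewrite /euclid_cons /= [RHS]tuple_eta.
have unconsK : cancel (@euclid_cons d) uncons.
  by move=> [x t]; congr pair; apply/val_inj.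
have muncons : measurable_fun setT uncons.
  by apply/measurable_fun_pair; [exact: measurable_tnth|exact: measurable_behead].
exists (fun n => uncons @^-1` (F n `*` G n)).
  rewrite -preimage_bigcup; apply/seteqP; split => // x _ /=.
  have [j _ Fj] : (\bigcup_k F k) (thead x) by rewrite -FT.
  have [k _ Gk] : (\bigcup_k G k) [tuple of behead x] by rewrite -GT.
  exists (maxn j k) => //; split.
    by move: Fj; exact/subsetPset/ndF/leq_maxl.
  by move: Gk; exact/subsetPset/ndG/leq_maxr.
move=> n; have [mF Fnoo] := Foo n; have [mG Gnoo] := Goo n; split.
  by rewrite -[X in measurable X]setTI; apply: muncons => //; exact: measurableX.
rewrite /lebesgue_step /pushforward -comp_preimage.
rewrite (_ : uncons \o _ = id); last by apply/funext => x; exact: unconsK.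
by rewrite preimage_id product_measure1E// lte_mul_pinfty// ge0_fin_numE.
Qed.

HB.instance Definition _ :=
  Measure_isSigmaFinite.Build _ _ _ lebesgue_step step_sigma_finite.

End step.

(* The d-fold product of [lebesgue_measure]; see [lebesgue_euclid_box]. *)
Fixpoint lebesgue_euclid d : {sigma_finite_measure set (euclid R d) -> \bar R} :=
  match d with
  | 0 => \d_([tuple] : euclid R 0)
  | d.+1 => lebesgue_step (lebesgue_euclid d)
  end.

End lebesgue_measure_euclid.
Arguments lebesgue_euclid R d : clear implicits.

Lemma lebesgue_euclid_box (R : realType) d (A : 'I_d -> set (measurableTypeR R)) :
  (forall i, measurable (A i)) ->
  lebesgue_euclid R d [set x | forall i, A i (tnth x i)] =
  (\prod_(i < d) lebesgue_measure (A i))%E.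
Proof.
elim: d A => [A _|d IH A mA].
  by rewrite big_ord0 /= diracE mem_set//= => -[].
rewrite big_ord_recl -IH; last by move=> i; exact: mA.
set B := [set x : euclid R d | _].
have mB : measurable B.
  rewrite (_ : B = \bigcap_(i in [set: 'I_d]) ((@tnth _ _)^~ i @^-1` A (lift ord0 i))).
    apply: fin_bigcap_measurable; first exact: finite_finset.
    by move=> i _; rewrite -[X in measurable X]setTI; apply: measurable_tnth.
  by apply/seteqP; split => x /=; [move=> h i _; exact: h|move=> h i; exact: h].
rewrite -product_measure1E//=.
rewrite /lebesgue_step /pushforward; congr (_ _).
apply/seteqP; split => [[x t]/= h|[x t]/= [Ax Bt] i].
  split; first exact: (h ord0).
  by move=> i; have := h (lift ord0 i); rewrite tnthS.
case: (unliftP ord0 i) => [j|] ->; last exact: Ax.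
by rewrite tnthS; exact: Bt.
Qed.

Section densities.
Variable R : realType.

Definition unit_cube d : set (euclid R d) :=
  [set x | forall j, 0 <= tnth x j <= 1].

(* Functions on [0,1] (resp. the unit cube) are encoded as total functions on
   R (resp. R^d) whose values outside [0,1] (resp. the cube) are never used. *)
Definition Lip_density (L : R) : set (R -> R) :=
  [set q | [/\ L.-lipschitz_`[0, 1] (q : R^o -> R^o),
               forall t, t \in `[0, 1] -> 0 <= q t
             & (\int[lebesgue_measure]_(t in `[0%R, 1%R]) (q t)%:E = 1)%E]].

Definition prob_simplex k : set ('I_k -> R) :=
  [set w | (forall i, 0 <= w i) /\ \sum_i w i = 1].

Definition multiview d : set (euclid R d -> R) :=
  [set p | exists k (w : 'I_k -> R) (L : R) (q : 'I_k -> 'I_d -> R -> R),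
    [/\ (0 < k)%N, prob_simplex w, 0 <= L,
        forall i j, Lip_density L (q i j)
      & forall x, unit_cube x -> p x = \sum_i w i * \prod_j q i j (tnth x j)]].

Definition l1norm d (f : euclid R d -> R) : R :=
  \int[lebesgue_euclid R d]_(x in @unit_cube d) `|f x|.

End densities.
Arguments unit_cube {R d}.

Section histogram.
Variables (R : realType) (d b : nat).

(* The multi-index has entries in {0, ..., b-1} rather than {1, ..., b}, hence
   the shift by one in the endpoints. *)
Definition cell (A : {ffun 'I_d -> 'I_b}) : set (euclid R d) :=
  [set x | forall j, (A j)%:R / b%:R <= tnth x j < (A j).+1%:R / b%:R].

Definition cell_density (A : {ffun 'I_d -> 'I_b}) (x : euclid R d) : R :=
  b%:R ^+ d * \1_(cell A) x.

Definition histogram n (X : 'I_n -> euclid R d) (x : euclid R d) : R :=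
  n%:R^-1 * \sum_(i < n) \sum_(A : {ffun 'I_d -> 'I_b})
    cell_density A x * \1_(cell A) (X i).

End histogram.

Section probability.
Context (R : realType) (disp : measure_display) (T : measurableType disp).
Variable P : probability T R.

Definition mutually_independent d' (T' : measurableType d')
    (X : nat -> {RV P >-> T'}) : Prop :=
  forall (J : {fset nat}) (A : nat -> set T'), (forall i, measurable (A i)) ->
    P (\bigcap_(i in [set` J]) X i @^-1` A i) =
    (\prod_(i <- J) P (X i @^-1` A i))%E.

(* [X 0], [X 1], ... are i.i.d. with density [p] on the unit cube. *)
Definition iid_density d (p : euclid R d -> R)
    (X : nat -> {RV P >-> euclid R d}) : Prop :=
  mutually_independent X /\
  forall i (A : set (euclid R d)), measurable A ->
    distribution P (X i) A =
    (\int[lebesgue_euclid R d]_(x in A `&` unit_cube) (p x)%:E)%E.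

Definition little_omega (f : nat -> T -> R) (g : nat -> R) : Prop :=
  forall M : R, P [set t | M < `|f n t / g n|] @[n --> \oo] --> 1%E.

End probability.

(* Main.v *)
Require Import Defs.
From HB Require Import structures.
From mathcomp Require Import all_boot all_order all_algebra finmap.
From mathcomp Require Import all_classical all_reals all_analysis.
From mathcomp Require Import measurable_realfun ring lra.
Set Implicit Arguments.
Unset Strict Implicit.
Unset Printing Implicit Defensive.
Import Order.TTheory GRing.Theory Num.Theory.
Import numFieldNormedType.Exports.
Local Open Scope classical_set_scope.
Local Open Scope ring_scope.

(** The bias of a histogram alone already exceeds the claimed rate, so no
    probability is involved.  Every value of the estimator is a function that is
    constant on the cells of the grid of side [1/b].  The density
    [p x = 2 * x_j], for one fixed coordinate [j], is a product of Lipschitz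
    densities on [0,1] and has slope 2 along [j]; hence no such step function
    approximates it to better than order [1/b], whatever its values
    ([l1norm_step_sub_linear]).  Since [n / b^d] tends to infinity, [b] is
    negligible with respect to the [d]-th root of [n] ([mul_bins_lt_root]), and
    the ratio of the statement is, for all large [n] and at every outcome, above
    any given bound: the events eventually are the whole space.

    The deterministic bound is obtained without iterating integrals.  On a cell,
    let [c] be the value of the step function, and compare it with the value of
    [p] at the middle of the cell.  If [c] is not larger, then
    [p - c >= 1/(2b)] on the last quarter of the cell along [j]; otherwise
    [c - p >= 1/(2b)] on the first quarter.  These quarters fill a set of
    volume 1/4, so the L1 distance is at least [1/(8b)]. *)

(** * Boxes and the L1 norm on the unit cube *)

Section boxes.
Variables (R : realType) (d : nat).

Lemma measurable_rectangle (A : 'I_d -> set (measurableTypeR R)) :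
  (forall j, measurable (A j)) ->
  measurable [set x : euclid R d | forall j, A j (tnth x j)].
Proof.
move=> mA; rewrite [X in measurable X](_ : _ =
    \bigcap_(j in [set: 'I_d]) ((@tnth _ _)^~ j @^-1` A j)).
  apply: fin_bigcap_measurable; first exact: finite_finset.
  by move=> j _; rewrite -[X in measurable X]setTI; exact: measurable_tnth.
by apply/seteqP; split => x /=; [move=> h j _; exact: h|move=> h j; exact: h].
Qed.

Definition box (l u : 'I_d -> R) : set (euclid R d) :=
  [set x | forall j, l j <= tnth x j < u j].

Lemma boxE (l u : 'I_d -> R) :
  box l u = [set x | forall j, [set` `[l j, u j[] (tnth x j)].
Proof. by apply/seteqP; split => x /= h j; move: (h j); rewrite in_itv. Qed.

Lemma measurable_box (l u : 'I_d -> R) : measurable (box l u).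
Proof.
rewrite boxE; apply: (measurable_rectangle (A := fun j => [set` `[l j, u j[])).
by move=> j; exact: measurable_itv.
Qed.

Lemma lebesgue_euclid_box_volume (l u : 'I_d -> R) :
  (forall j, l j <= u j) ->
  lebesgue_euclid R d (box l u) = (\prod_j (u j - l j))%:E.
Proof.
move=> lu; rewrite boxE.
rewrite (lebesgue_euclid_box (A := fun j => [set` `[l j, u j[])); last first.
  by move=> j; exact: measurable_itv.
rewrite -prodEFin; apply: eq_bigr => j _.
rewrite lebesgue_measure_itv/= lte_fin; case: ltP => // ul.
by rewrite (le_anti (introT andP (conj (lu j) ul))) subrr.
Qed.

Lemma measurable_unit_cube : measurable (@unit_cube R d).
Proof.
rewrite (_ : unit_cube = [set x | forall j, [set` `[0, 1]] (tnth x j)]).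
  by apply: (measurable_rectangle
    (A := fun=> [set` `[0, 1]])) => j; exact: measurable_itv.
by apply/seteqP; split => x /= h j; move: (h j); rewrite in_itv.
Qed.

Lemma lebesgue_euclid_unit_cube : lebesgue_euclid R d unit_cube = 1%E.
Proof.
rewrite (_ : unit_cube = [set x | forall j, [set` `[0, 1]] (tnth x j)]).
  rewrite (lebesgue_euclid_box (A := fun=> [set` `[0, 1]])); last first.
    by move=> j; exact: measurable_itv.
  by apply: big1 => j _; rewrite lebesgue_measure_itv/= lte_fin ltr01 sube0.
by apply/seteqP; split => x /= h j; move: (h j); rewrite in_itv.
Qed.

(** Markov's inequality for [l1norm].  The norm is a real-valued integral, which
    is 0 when the integral diverges; the uniform bound [M] excludes this. *)
Lemma l1norm_markov (f : euclid R d -> R) (E : set (euclid R d)) (e m M : R) :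
  measurable_fun setT f -> (forall x, unit_cube x -> `|f x| <= M) ->
  measurable E -> E `<=` unit_cube -> 0 <= e ->
  (forall x, E x -> e <= `|f x|) ->
  (m%:E <= lebesgue_euclid R d E)%E -> e * m <= l1norm f.
Proof.
move=> mf fM mE Ecube e0 ef mme; rewrite /l1norm /Rintegral.
have mcube := measurable_unit_cube.
have mnf D : measurable_fun D (fun x => (`|f x|)%:E).
  apply/measurable_EFinP; apply: measurableT_comp => //.
  exact: measurable_funTS.
have Elb : ((e * m)%:E <= \int[lebesgue_euclid R d]_(x in unit_cube) (`|f x|)%:E)%E.
  apply: (@le_trans _ _ (\int[lebesgue_euclid R d]_(x in E) (`|f x|)%:E)%E).
    apply: (@le_trans _ _ (\int[lebesgue_euclid R d]_(x in E) (cst e%:E x))%E).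
      by rewrite integral_cst// EFinM lee_wpmul2l.
    by apply: ge0_le_integral.
  by apply: ge0_subset_integral.
have Eub : (\int[lebesgue_euclid R d]_(x in unit_cube) (`|f x|)%:E <= M%:E)%E.
  apply: (@le_trans _ _ (\int[lebesgue_euclid R d]_(x in unit_cube) (cst M%:E x))%E).
    by apply: ge0_le_integral.
  by rewrite integral_cst// [X in (_ * X)%E]lebesgue_euclid_unit_cube mule1.
rewrite -lee_fin fineK// ge0_fin_numE; last exact: integral_ge0.
by rewrite (le_lt_trans Eub) ?ltry.
Qed.

End boxes.

(** * Step functions on the grid are far from linear functions *)

Section lower_bound.
Variables (R : realType) (d b : nat).
Hypothesis b_gt0 : (0 < b)%N.
Implicit Types (A : {ffun 'I_d -> 'I_b}) (c : {ffun 'I_d -> 'I_b} -> R).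

Lemma cell_inj A A' (x : euclid R d) : cell A x -> cell A' x -> A = A'.
Proof.
have b0 : 0 < b%:R^-1 :> R by rewrite invr_gt0 ltr0n.
move=> Ax A'x; apply/ffunP => j; apply/val_inj/eqP => /=.
move: (Ax j) (A'x j) => /andP[lx xu] /andP[l'x xu'].
have := le_lt_trans lx xu'; have := le_lt_trans l'x xu.
by rewrite !ltr_pM2r// !ltr_nat !ltnS eqn_leq => -> ->.
Qed.

Definition step_fun c (x : euclid R d) : R := \sum_A c A * \1_(cell A) x.

Lemma histogram_step n (X : 'I_n -> euclid R d) :
  histogram b X =
  step_fun (fun A => n%:R^-1 * \sum_(i < n) b%:R ^+ d * \1_(cell A) (X i)).
Proof.
apply/funext => x; rewrite /histogram /step_fun exchange_big mulr_sumr.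
apply: eq_bigr => A _; rewrite -mulrA mulr_suml; congr (_ * _).
by apply: eq_bigr => i _; rewrite /cell_density mulrAC.
Qed.

Lemma step_fun_cell c A (x : euclid R d) : cell A x -> step_fun c x = c A.
Proof.
move=> Ax; rewrite /step_fun (bigD1 A)//= indicE mem_set// mulr1 big1 ?addr0//.
move=> A' A'A; rewrite indicE memNset ?mulr0// => A'x.
by move: A'A; rewrite (cell_inj A'x Ax) eqxx.
Qed.

Lemma measurable_step_fun c : measurable_fun setT (step_fun c).
Proof.
apply: measurable_sum => A; apply: measurable_funM => //.
by apply: measurable_indic; exact: measurable_box.
Qed.

Lemma step_fun_bounded c (x : euclid R d) : `|step_fun c x| <= \sum_A `|c A|.
Proof.
apply: (le_trans (ler_norm_sum _ _ _)); apply: ler_sum => A _.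
by rewrite normrM ler_piMr// indicE; case: (_ \in _); rewrite ?normr1 ?normr0.
Qed.

Variable j0 : 'I_d.

(** The endpoints of the quarter of the cell [A], along the coordinate [j0], on
    which [2 * tnth x j0] is far from the constant [c A]; the test
    compares [c A] with [(2 * A j0 + 1) / b], the value of the linear function
    in the middle of the cell. *)
Definition slab_lower c A j : R :=
  ((A j)%:R +
   (if (j == j0) && (c A <= ((A j0)%:R *+ 2 + 1) / b%:R) then 3 / 4 else 0))
    / b%:R.

Definition slab_upper c A j : R :=
  ((A j)%:R +
   (if (j == j0) && (((A j0)%:R *+ 2 + 1) / b%:R < c A) then 1 / 4 else 1))
    / b%:R.

Definition far_slab c A : set (euclid R d) := box (slab_lower c A) (slab_upper c A).

Lemma far_slab_sub_cell c A : far_slab c A `<=` cell A.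
Proof.
have b0 : 0 < b%:R^-1 :> R by rewrite invr_gt0 ltr0n.
move=> x /= h j; move: (h j); rewrite /slab_lower /slab_upper => /andP[lx xu].
apply/andP; split.
  by apply: le_trans lx; rewrite ler_pM2r// lerDl; case: ifP => _ //; lra.
apply: (lt_le_trans xu); rewrite ler_pM2r// -[(A j).+1%:R]natr1 lerD2l.
by case: ifP => _ //; lra.
Qed.

(** The linear function has slope 2 and the slab stays at distance [1/(4b)] from
    the middle of the cell, on the side that moves away from [c A]. *)
Lemma far_slab_dist c A (x : euclid R d) :
  far_slab c A x -> (2 * b%:R)^-1 <= `|step_fun c x - 2 * tnth x j0|.
Proof.
move=> gx; rewrite (step_fun_cell c (far_slab_sub_cell gx)).
have b0 : 0 < b%:R^-1 :> R by rewrite invr_gt0 ltr0n.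
move: (gx j0); rewrite /slab_lower /slab_upper eqxx /= invfM.
move: b%:R^-1 b0 (A j0)%:R (tnth x j0) (c A) => h h0 a t v.
case: (leP v _) => hv /andP[lo hi].
  by rewrite ler_normr; apply/orP; right; nra.
by rewrite ler_normr; apply/orP; left; nra.
Qed.

Lemma far_slab_volume c A :
  lebesgue_euclid R d (far_slab c A) = (4^-1 * b%:R^-1 ^+ d)%:E.
Proof.
have b0 : 0 < b%:R^-1 :> R by rewrite invr_gt0 ltr0n.
rewrite lebesgue_euclid_box_volume => [|j]; last first.
  rewrite /slab_lower /slab_upper ler_pM2r// lerD2l.
  by case: (j == j0) => /=; [case: leP => _|]; lra.
congr EFin.
rewrite (bigD1 j0)//= (eq_bigr (fun=> b%:R^-1)) => [|j /negbTE jj0]; last first.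
  by rewrite /slab_lower /slab_upper jj0/= -mulrBl; ring.
rewrite prodr_const cardC1 card_ord.
rewrite /slab_lower /slab_upper eqxx/=.
have -> : b%:R^-1 ^+ d = b%:R^-1 * b%:R^-1 ^+ d.-1 :> R.
  by rewrite -exprS prednK//; exact: leq_ltn_trans (ltn_ord j0).
rewrite [RHS]mulrA; congr (_ * _); case: leP => _; lra.
Qed.

Lemma far_slabs_volume c :
  lebesgue_euclid R d (\bigcup_(A in [set: {ffun 'I_d -> 'I_b}]) far_slab c A) =
  (4^-1)%:E.
Proof.
rewrite measure_fin_bigcup//=.
- rewrite (fsbigE (index_enum {ffun 'I_d -> 'I_b}))//=; last 2 first.
  + exact: index_enum_uniq.
  + by move=> A _; rewrite mem_index_enum.
  under eq_bigl do rewrite in_setT.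
  under eq_bigr do rewrite far_slab_volume.
  rewrite sumEFin sumr_const card_ffun !card_ord; congr EFin.
  rewrite -[LHS]mulr_natr natrX -mulrA -exprMn mulVf ?expr1n ?mulr1//.
  by rewrite pnatr_eq0 -lt0n.
- move=> A A' _ _ [x [/far_slab_sub_cell Ax /far_slab_sub_cell A'x]].
  exact: cell_inj Ax A'x.
- by move=> A _; exact: measurable_box.
Qed.

(** The bound is uniform in the coefficients [c], hence applies to coefficients
    that depend on random data. *)
Lemma l1norm_step_sub_linear c :
  (8 * b%:R)^-1 <= l1norm (step_fun c \- (fun x => 2 * tnth x j0)).
Proof.
have bR : 0 < b%:R :> R by rewrite ltr0n.
rewrite (_ : (8 * b%:R)^-1 = (2 * b%:R)^-1 * 4^-1); last first.
  by field; rewrite gt_eqF.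
apply: (@l1norm_markov _ _ _ (\bigcup_(A in [set: {ffun 'I_d -> 'I_b}]) far_slab c A)
  _ _ (\sum_A `|c A| + 2)).
- apply: measurable_funB; first exact: measurable_step_fun.
  by apply: measurable_funM => //; exact: measurable_tnth.
- move=> x xcube /=; apply: (le_trans (ler_normB _ _)).
  apply: lerD; first exact: step_fun_bounded.
  have /andP[x0 x1] := xcube j0.
  by rewrite ger0_norm ?mulr_ge0// ler_piMr.
- apply: fin_bigcup_measurable; first exact: finite_finset.
  by move=> A _; exact: measurable_box.
- move=> x [A _ /far_slab_sub_cell Ax] j; have /andP[lx xu] := Ax j.
  apply/andP; split; first by apply: le_trans lx; rewrite divr_ge0.
  by apply: (ltW (lt_le_trans xu _)); rewrite ler_pdivrMr// mul1r ler_nat.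
- by rewrite invr_ge0 mulr_ge0.
- by move=> x [A _]; exact: far_slab_dist.
- by rewrite far_slabs_volume.
Qed.

End lower_bound.

(** * The linear density *)

Section target.
Variable R : realType.

Lemma Lip_density_cst : Lip_density (2 : R) (fun=> 1).
Proof.
split.
- by move=> [x y] _ /=; rewrite subrr normr0 mulr_ge0.
- by [].
- by rewrite integral_cst//= lebesgue_measure_itv/= lte_fin ltr01 sube0 mule1.
Qed.

Lemma Lip_density_linear : Lip_density (2 : R) (fun t => 2 * t).
Proof.
split.
- by move=> [x y] _ /=; rewrite -mulrBr normrM ger0_norm.
- by move=> t; rewrite in_itv/= => /andP[t0 _]; rewrite mulr_ge0.
- rewrite (@continuous_FTC2 _ _ (fun t => t ^+ 2)) //.
  + by rewrite -EFinB expr1n expr0n/= subr0.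
  + apply: continuous_subspaceT => x.
    by apply: cvgM; [exact: cvg_cst|exact: cvg_id].
  + have cX : continuous (fun t : R => t ^+ 2) by move=> t; exact: exprn_continuous.
    split.
    * by move=> x _; exact: exprn_derivable.
    * exact/cvg_at_right_filter/cX.
    * exact/cvg_at_left_filter/cX.
  + by move=> x _; rewrite exp_derive1 expr1.
Qed.

Lemma multiview_linear d (j0 : 'I_d) :
  multiview (fun x : euclid R d => 2 * tnth x j0).
Proof.
exists 1%N, (fun=> 1), 2, (fun _ j t => if j == j0 then 2 * t else 1).
split => //.
- by split => //; rewrite big_ord1.
- by move=> _ j; case: (j == j0); [exact: Lip_density_linear|exact: Lip_density_cst].
- move=> x _; rewrite big_ord1 mul1r (bigD1 j0)//= eqxx big1 ?mulr1//.
  by move=> j /negbTE ->.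
Qed.

End target.

(** * The number of bins against the root of the sample size *)

Lemma mul_bins_lt_root (R : realType) (d : nat) (d_gt0 : (0 < d)%N)
    (b : nat -> nat) (b_gt0 : forall n, (0 < n)%N -> (0 < b n)%N)
    (nb : n%:R / (b n)%:R ^+ d @[n --> \oo] --> (+oo : set_system R)) (M : R) :
  \forall n \near \oo, M * (b n)%:R < n%:R `^ (d%:R^-1).
Proof.
(* The comparison is made between [d]-th powers, which needs a nonnegative
   factor. *)
pose M' := Num.max M 0.
have M'0 : 0 <= M' by rewrite le_max lexx orbT.
move/cvgryPgt : nb => /(_ (M' ^+ d)); apply: filter_app.
near=> n.
have n0 : (0 < n)%N by near: n; exact: nbhs_infty_gt.
have bR : 0 < (b n)%:R :> R by rewrite ltr0n b_gt0.
rewrite ltr_pdivlMr ?exprn_gt0// -exprMn => Mn.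
apply: (@le_lt_trans _ _ (M' * (b n)%:R)).
  by rewrite ler_pM2r// le_max lexx.
rewrite -(ltr_pXn2r d_gt0) ?nnegrE ?mulr_ge0 ?powR_ge0// ?ltW//.
rewrite -[ltRHS]powR_mulrn ?powR_ge0// -powRrM mulVf ?pnatr_eq0 -?lt0n//.
by rewrite powRr1.
Unshelve. all: by end_near. Qed.

Theorem proposition2p3 (R : realType) (d : nat) (d_gt0 : (0 < d)%N)
    (b : nat -> nat) (b_gt0 : forall n, (0 < n)%N -> (0 < b n)%N)
    (nb : n%:R / (b n)%:R ^+ d @[n --> \oo] --> (+oo : set_system R)) :
  exists2 p : euclid R d -> R, multiview p &
    forall (disp : measure_display) (T : measurableType disp)
      (P : probability T R) (X : nat -> {RV P >-> euclid R d}),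
    iid_density p X ->
    little_omega P
      (fun n t => l1norm (histogram (b n) (fun i : 'I_n => X i t) \- p))
      (fun n => 1 / n%:R `^ (d%:R^-1)).
Proof.
exists (fun x => 2 * tnth x (Ordinal d_gt0)); first exact: multiview_linear.
move=> disp T P X _ M.
apply: cvg_near_cst; near=> n.
have n0 : (0 < n)%N by near: n; exact: nbhs_infty_gt.
have bR : 0 < (b n)%:R :> R by rewrite ltr0n b_gt0.
have Mn : M * 8 * (b n)%:R < n%:R `^ (d%:R^-1).
  by near: n; exact: mul_bins_lt_root.
rewrite [X in P X](_ : _ = setT) ?probability_setT//.
apply/seteqP; split => // t _ /=.
apply: lt_le_trans (ler_norm _); rewrite div1r invrK histogram_step.
set c := (fun A => _).
have lb := l1norm_step_sub_linear (b_gt0 _ n0) (Ordinal d_gt0) c.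
apply: lt_le_trans (ler_wpM2r (powR_ge0 _ _) lb).
by rewrite mulrC ltr_pdivlMr ?mulr_gt0// mulrA.
Unshelve. all: by end_near. Qed.
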